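(* Let $RL^n=(J^1(\mathbb{R},M),L)$ be a relativistic rheonomic Lagrange space with respect to the semi-Riemannian metric $h=(h_{11})$ on $\mathbb{R}$, let $C\Gamma$ be its Cartan canonical connection, and let $$G=h_{11}dt\otimes dt+g_{ij}dx^i\otimes dx^j+h^{11}g_{ij}\delta y^i\otimes\delta y^j$$ be the induced gravitational $h$-potential. The Einstein equations $$Ric(C\Gamma)-\frac{Sc(C\Gamma)}{2}G=\mathcal{K}\mathcal{T}$$ which govern $G$ have, in the adapted basis, the form $$\left\{\begin{array}{l}-\frac{R+S}{2}h_{11}=\mathcal{K}\mathcal{T}_{11}\\[2pt] R_{ij}-\frac{R+S}{2}g_{ij}=\mathcal{K}\mathcal{T}_{ij}\\[2pt] S^{(1)(1)}_{(i)(j)}-\frac{R+S}{2}h^{11}g_{ij}=\mathcal{K}\mathcal{T}^{(1)(1)}_{(i)(j)}\end{array}\right.$$ together with $$\left\{\begin{array}{lll}0=\mathcal{T}_{1i},&R_{i1}=\mathcal{K}\mathcal{T}_{i1},&P^{(1)}_{(i)1}=\mathcal{K}\mathcal{T}^{(1)}_{(i)1}\\[2pt] 0=\mathcal{T}^{\;(1)}_{1(i)},&P^{\;(1)}_{i(j)}=\mathcal{K}\mathcal{T}^{\;(1)}_{i(j)},&P^{(1)}_{(i)j}=\mathcal{K}\mathcal{T}^{(1)}_{(i)j},\end{array}\right.$$ where $\mathcal{T}_{AB}$ denote the adapted local components of the stress-energy d-tensor $\mathcal{T}$, with $A,B$ running over $1$, $i$ and the vertical indices $(i)$.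
   Context: $M$ is a smooth $n$-dimensional manifold; $E=J^1(\mathbb{R},M)\equiv\mathbb{R}\times TM$ has local coordinates $(t,x^i,y^i)$, latin indices run from $1$ to $n$, the index $1$ refers to the time axis, repeated latin indices are summed. Coordinate changes are $\tilde t=\tilde t(t)$, $\tilde x^i=\tilde x^i(x^j)$, $\tilde y^i=\frac{\partial\tilde x^i}{\partial x^j}\frac{dt}{d\tilde t}y^j$. $h=(h_{11}(t))$ is a semi-Riemannian metric on $\mathbb{R}$, $h^{11}=1/h_{11}$, $H^1_{11}=\frac{h^{11}}{2}\frac{dh_{11}}{dt}$. A smooth $L:E\to\mathbb{R}$ is Kronecker $h$-regular if $\frac12\frac{\partial^2L}{\partial y^i\partial y^j}=h^{11}(t)g_{ij}(t,x^k,y^k)$ with $g_{ij}$ a symmetric d-tensor ($\tilde g_{ij}=\frac{\partial x^k}{\partial\tilde x^i}\frac{\partial x^l}{\partial\tilde x^j}g_{kl}$) of rank $n$ and constant signature; $(g^{ij})=(g_{ij})^{-1}$. Then $RL^n=(E,L)$ is a relativistic rheonomic Lagrange space. Canonical nonlinear connection: $M^{(i)}_{(1)1}=-H^1_{11}y^i$, $N^{(i)}_{(1)j}=\partial G^{(i)}_{(1)1}/\partial y^j$ with $$G^{(i)}_{(1)1}=\frac{h_{11}g^{ik}}{4}\left[\frac{\partial^2L}{\partial x^j\partial y^k}y^j-\frac{\partial L}{\partial x^k}+\frac{\partial^2L}{\partial t\partial y^k}+\frac{\partial L}{\partial y^k}H^1_{11}+2h^{11}H^1_{11}g_{kl}y^l\right].$$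 Adapted basis $(X_A)$: $\frac{\delta}{\delta t}=\frac{\partial}{\partial t}-M^{(j)}_{(1)1}\frac{\partial}{\partial y^j}$, $\frac{\delta}{\delta x^i}=\frac{\partial}{\partial x^i}-N^{(j)}_{(1)i}\frac{\partial}{\partial y^j}$, $\frac{\partial}{\partial y^i}$, with dual basis $dt$, $dx^i$, $\delta y^i=dy^i+M^{(i)}_{(1)1}dt+N^{(i)}_{(1)j}dx^j$; the corresponding indices are written $1$, $i$, and $(i)$ (vertical, accompanied by $(1)$ at the opposite level). Cartan canonical connection $C\Gamma$: with $G^k_{j1}=\frac{g^{ki}}2\frac{\delta g_{ij}}{\delta t}$, $L^i_{jk}=\frac{g^{im}}2\left(\frac{\delta g_{jm}}{\delta x^k}+\frac{\delta g_{km}}{\delta x^j}-\frac{\delta g_{jk}}{\delta x^m}\right)$, $C^{i(1)}_{j(k)}=\frac{g^{im}}2\left(\frac{\partial g_{jm}}{\partial y^k}+\frac{\partial g_{km}}{\partial y^j}-\frac{\partial g_{jk}}{\partial y^m}\right)$, it is the linear connection $\nabla$ with $\nabla_{\delta/\delta t}\frac{\delta}{\delta t}=H^1_{11}\frac{\delta}{\delta t}$, $\nabla_{\delta/\delta t}\frac{\delta}{\delta x^i}=G^k_{i1}\frac{\delta}{\delta x^k}$, $\nabla_{\delta/\delta t}\frac{\partial}{\partial y^i}=(G^k_{i1}-\delta^k_iH^1_{11})\frac{\partial}{\partial y^k}$, $\nabla_{\delta/\delta x^j}\frac{\delta}{\delta t}=0$, $\nabla_{\delta/\delta x^j}\frac{\delta}{\delta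 x^i}=L^k_{ij}\frac{\delta}{\delta x^k}$, $\nabla_{\delta/\delta x^j}\frac{\partial}{\partial y^i}=L^k_{ij}\frac{\partial}{\partial y^k}$, $\nabla_{\partial/\partial y^j}\frac{\delta}{\delta t}=0$, $\nabla_{\partial/\partial y^j}\frac{\delta}{\delta x^i}=C^{k(1)}_{i(j)}\frac{\delta}{\delta x^k}$, $\nabla_{\partial/\partial y^j}\frac{\partial}{\partial y^i}=C^{k(1)}_{i(j)}\frac{\partial}{\partial y^k}$. Curvature: $\mathbf{R}(X,Y)Z=\nabla_X\nabla_YZ-\nabla_Y\nabla_XZ-\nabla_{[X,Y]}Z$ and $\mathbf{R}(X_C,X_B)X_A=R^D_{ABC}X_D$. The effective components are $R^l_{i1k}$, $R^l_{ijk}$, $P^{l\;\;(1)}_{i1(k)}$, $P^{l\;(1)}_{ij(k)}$, $S^{l(1)(1)}_{i(j)(k)}$, defined by $\mathbf{R}(\frac{\delta}{\delta x^k},\frac{\delta}{\delta t})\frac{\delta}{\delta x^i}=R^l_{i1k}\frac{\delta}{\delta x^l}$, $\mathbf{R}(\frac{\delta}{\delta x^k},\frac{\delta}{\delta x^j})\frac{\delta}{\delta x^i}=R^l_{ijk}\frac{\delta}{\delta x^l}$, $\mathbf{R}(\frac{\partial}{\partial y^k},\frac{\delta}{\delta t})\frac{\delta}{\delta x^i}=P^{l\;\;(1)}_{i1(k)}\frac{\delta}{\delta x^l}$, $\mathbf{R}(\frac{\partial}{\partial y^k},\frac{\delta}{\delta x^j})\frac{\delta}{\delta x^i}=P^{l\;(1)}_{ij(k)}\frac{\delta}{\delta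 x^l}$, $\mathbf{R}(\frac{\partial}{\partial y^k},\frac{\partial}{\partial y^j})\frac{\delta}{\delta x^i}=S^{l(1)(1)}_{i(j)(k)}\frac{\delta}{\delta x^l}$; the same coefficients occur when $\frac{\delta}{\delta x^i},\frac{\delta}{\delta x^l}$ are replaced by $\frac{\partial}{\partial y^i},\frac{\partial}{\partial y^l}$. Ricci d-tensor: $Ric(C\Gamma)(X_A,X_B)=R_{AB}=R^D_{ABD}$; scalar curvature $Sc(C\Gamma)=G^{AB}R_{AB}$, $(G^{AB})$ the inverse of the metric $G$. Notation: $R_{i1}=R^m_{i1m}$, $R_{ij}=R^m_{ijm}$, $P^{\;(1)}_{i(j)}=-P^{m\;\;(1)}_{im(j)}$, $P^{(1)}_{(i)1}=P^{m\;\;(1)}_{i1(m)}$, $P^{(1)}_{(i)j}=P^{m\;\;(1)}_{ij(m)}$, $S^{(1)(1)}_{(i)(j)}=S^{m(1)(1)}_{i(j)(m)}$, $R=g^{ij}R_{ij}$, $S=h_{11}g^{ij}S^{(1)(1)}_{(i)(j)}$. $\mathcal{K}$ is the (nonzero) Einstein constant and $\mathcal{T}$ is a given d-tensor of type $(0,2)$, the stress-energy d-tensor, with components $\mathcal{T}_{AB}=\mathcal{T}(X_A,X_B)$. *)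

(* Defs.v *)
From HB Require Import structures.
From mathcomp Require Import all_boot all_order all_algebra.
From mathcomp Require Import boolp classical_sets reals topology normedtype.
From mathcomp Require Import derive.

Set Implicit Arguments.
Unset Strict Implicit.
Unset Printing Implicit Defensive.

Import Order.TTheory GRing.Theory Num.Theory.
Import numFieldNormedType.Exports.

Local Open Scope classical_set_scope.
Local Open Scope ring_scope.

(* C^infinity on U: all iterated directional derivatives are differentiable
   on U.  For open U this only depends on the restriction of f to U. *)
Definition smooth_on (R : realType) (V W : normedModType R) (U : set V)
    (f : V -> W) : Prop :=
  forall (vs : seq V) (x : V), U x ->
    differentiable (foldr (fun v k (y : V) => 'D_v k y) f vs) x.

(* A diffeomorphism between two open subsets of the time axis. *)
Record time_chart (R : realType) := TimeChart {
  tdom : set R;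
  tmap : R -> R;
  tinv : R -> R;
  tdom_open : open tdom;
  tran_open : open (tmap @` tdom);
  tmapK : forall t, tdom t -> tinv (tmap t) = t;
  tmap_smooth : smooth_on tdom tmap;
  tinv_smooth : smooth_on (tmap @` tdom) tinv
}.

Record smooth_manifold (R : realType) (n : nat) := SmoothManifold {
  pts :> topologicalType;
  pts_hausdorff : hausdorff_space pts;
  pts_countable : @second_countable pts;
  chart : Type;
  xdom : chart -> set pts;
  xmap : chart -> pts -> 'rV[R]_n;
  xinv : chart -> 'rV[R]_n -> pts;
  xdom_open : forall a, open (xdom a);
  xran_open : forall a, open (xmap a @` xdom a);
  xmapK : forall a p, xdom a p -> xinv a (xmap a p) = p;
  xmap_continuous : forall a, {within xdom a, continuous (xmap a)};
  xinv_continuous : forall a, {within xmap a @` xdom a, continuous (xinv a)};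
  xdom_cover : forall p, exists a, xdom a p;
  transition_smooth : forall a b,
    smooth_on (xmap a @` (xdom a `&` xdom b)) (xmap b \o xinv a)
}.

Section JetBundle.
Variables (R : realType) (n : nat) (M : smooth_manifold R n).

Definition transition (a b : chart M) : 'rV[R]_n -> 'rV[R]_n :=
  xmap b \o xinv a.

(* A tangent vector at [foot] is the contravariant family of its components
   in all the charts around [foot]; the components in the other charts are
   set to 0 so that each vector has a unique representative. *)
Record tangent_bundle := TangentVector {
  foot : M;
  tcomp : chart M -> 'rV[R]_n;
  tcomp_out : forall a, ~ xdom a foot -> tcomp a = 0;
  tcomp_trans : forall a b, xdom a foot -> xdom b foot ->
    tcomp b = 'D_(tcomp a) (transition a b) (xmap a foot)
}.

(* J^1(R, M), identified with R x TM. *)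
Definition jet : Type := (R * tangent_bundle)%type.

(* The space of coordinates (t, x, y). *)
Definition coords : Type := (R * 'rV[R]_n * 'rV[R]_n)%type.

Definition jet_chart : Type := (time_chart R * chart M)%type.

Definition jdom (C : jet_chart) : set jet :=
  [set e | tdom C.1 e.1 /\ xdom C.2 (foot e.2)].

(* The fibre coordinates are those of the 1-jet of a curve with respect to
   the time coordinate s = tmap t: they carry the factor dt/ds. *)
Definition jmap (C : jet_chart) (e : jet) : coords :=
  let s := tmap C.1 e.1 in
  (s, xmap C.2 (foot e.2), derive1 (tinv C.1) s *: tcomp e.2 C.2).

Definition jran (C : jet_chart) : set coords :=
  [set z | (tmap C.1 @` tdom C.1) z.1.1 /\ (xmap C.2 @` xdom C.2) z.1.2].

Definition local_expr (C : jet_chart) (f : jet -> R) (z : coords) : R :=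
  xget 0 [set r | exists2 e, jdom C e & jmap C e = z /\ f e = r].

(* Image under C of the intersection of the domains of C and C'. *)
Definition joverlap (C C' : jet_chart) : set coords :=
  [set z | (tmap C.1 @` (tdom C.1 `&` tdom C'.1)) z.1.1 /\
           (xmap C.2 @` (xdom C.2 `&` xdom C'.2)) z.1.2].

(* (t, x, y) |-> (t~(t), x~(x), (dx~/dx) (dt/dt~) y), from C to C'. *)
Definition jchange (C C' : jet_chart) (z : coords) : coords :=
  let s := tmap C'.1 (tinv C.1 z.1.1) in
  (s, transition C.2 C'.2 z.1.2,
   derive1 (tmap C.1 \o tinv C'.1) s *:
     'D_(z.2) (transition C.2 C'.2) z.1.2).

End JetBundle.

(* Indices of the coordinates (t, x^i, y^i), and of the adapted basis. *)
Definition jindex (n : nat) : finType := (unit + 'I_n + 'I_n)%type.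
Definition it {n : nat} : jindex n := inl (inl tt).
Definition ix {n : nat} (i : 'I_n) : jindex n := inl (inr i).
Definition iy {n : nat} (i : 'I_n) : jindex n := inr i.

Section LocalGeometry.
Variables (R : realType) (n : nat).
Local Notation E := (coords R n).
Local Notation I := (jindex n).

Definition jcoord (a : I) (z : E) : R :=
  match a with
  | inl (inl _) => z.1.1
  | inl (inr i) => z.1.2 0 i
  | inr i => z.2 0 i
  end.

Definition unit_vec (a : I) : E :=
  match a with
  | inl (inl _) => (1, 0, 0)
  | inl (inr i) => (0, delta_mx 0 i, 0)
  | inr i => (0, 0, delta_mx 0 i)
  end.

Definition partial (a : I) (f : E -> R) (z : E) : R := 'D_(unit_vec a) f z.

(* Vectors and vector fields are given by their components in the natural
   basis d/dt, d/dx^i, d/dy^i. *)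
Definition tvec : Type := I -> R.
Definition vfield : Type := E -> tvec.

Definition lie_deriv (X : vfield) (f : E -> R) (z : E) : R :=
  \sum_a X z a * partial a f z.

Definition bracket (X Y : vfield) : vfield := fun z a =>
  lie_deriv X (fun w => Y w a) z - lie_deriv Y (fun w => X w a) z.

Definition tensor_eval (T : I -> I -> R) (u v : tvec) : R :=
  \sum_a \sum_b T a b * u a * v b.

(* Sylvester normal form with p plus signs and q minus signs. *)
Definition has_signature (p q : nat) (A : 'M[R]_n) : Prop :=
  exists2 P : 'M[R]_n, P \in unitmx &
    P *m A *m P^T =
      diag_mx (\row_i (if (i < p)%N then 1
                       else if (i < p + q)%N then -1 else 0)).

(* Expressions, in one chart, of h_11, of the Lagrangian and of g_ij. *)
Variables (h : R -> R) (L : E -> R) (g : E -> 'M[R]_n).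

Definition h_inv (t : R) : R := (h t)^-1.
Definition H (t : R) : R := h_inv t / 2 * derive1 h t.
Definition g_inv (z : E) : 'M[R]_n := invmx (g z).

Definition spray (i : 'I_n) (z : E) : R :=
  let t := z.1.1 in let y := z.2 in
  \sum_k h t * g_inv z i k / 4 *
    (\sum_j partial (ix j) (partial (iy k) L) z * y 0 j
     - partial (ix k) L z
     + partial it (partial (iy k) L) z
     + partial (iy k) L z * H t
     + 2 * h_inv t * H t * \sum_l g z k l * y 0 l).

Definition nlc_t (i : 'I_n) (z : E) : R := - H z.1.1 * z.2 0 i.
Definition nlc_x (i j : 'I_n) (z : E) : R := partial (iy j) (spray i) z.

Definition frame (A : I) : vfield := fun z a =>
  match A, a with
  | inl (inl _), inl (inl _) => 1
  | inl (inl _), inr j => - nlc_t j z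
  | inl (inr i), inl (inr k) => (k == i)%:R
  | inl (inr i), inr j => - nlc_x j i z
  | inr i, inr j => (j == i)%:R
  | _, _ => 0
  end.

(* The dual basis dt, dx^i, delta y^i. *)
Definition coframe (A : I) (z : E) (u : tvec) : R :=
  match A with
  | inl (inl _) => u it
  | inl (inr i) => u (ix i)
  | inr i => u (iy i) + nlc_t i z * u it + \sum_j nlc_x i j z * u (ix j)
  end.

Definition cartan_G (k j : 'I_n) (z : E) : R :=
  \sum_i g_inv z k i / 2 * lie_deriv (frame it) (fun w => g w i j) z.

Definition cartan_L (i j k : 'I_n) (z : E) : R :=
  \sum_m g_inv z i m / 2 *
    (lie_deriv (frame (ix k)) (fun w => g w j m) z
     + lie_deriv (frame (ix j)) (fun w => g w k m) z
     - lie_deriv (frame (ix m)) (fun w => g w j k) z).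

Definition cartan_C (i j k : 'I_n) (z : E) : R :=
  \sum_m g_inv z i m / 2 *
    (partial (iy k) (fun w => g w j m) z
     + partial (iy j) (fun w => g w k m) z
     - partial (iy m) (fun w => g w j k) z).

(* [cartan C A B] is the coefficient of X_C in nabla_{X_B} X_A. *)
Definition cartan (C A B : I) (z : E) : R :=
  match B, A, C with
  | inl (inl _), inl (inl _), inl (inl _) => H z.1.1
  | inl (inl _), inl (inr i), inl (inr k) => cartan_G k i z
  | inl (inl _), inr i, inr k => cartan_G k i z - (k == i)%:R * H z.1.1
  | inl (inr j), inl (inr i), inl (inr k) => cartan_L k i j z
  | inl (inr j), inr i, inr k => cartan_L k i j z
  | inr j, inl (inr i), inl (inr k) => cartan_C k i j z
  | inr j, inr i, inr k => cartan_C k i j z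
  | _, _, _ => 0
  end.

(* The linear connection with these coefficients, extended from the adapted
   basis by linearity and the Leibniz rule. *)
Definition nabla (X Y : vfield) : vfield := fun z a =>
  \sum_C (lie_deriv X (fun w => coframe C w (Y w)) z
          + \sum_A \sum_B
              cartan C A B z * coframe A z (Y z) * coframe B z (X z))
         * frame C z a.

Definition curvature (X Y Z : vfield) : vfield := fun z a =>
  nabla X (nabla Y Z) z a - nabla Y (nabla X Z) z a
  - nabla (bracket X Y) Z z a.

(* R^D_{ABC}, where R(X_C, X_B) X_A = R^D_{ABC} X_D. *)
Definition curv_coef (D A B C : I) (z : E) : R :=
  coframe D z (curvature (frame C) (frame B) (frame A) z).

Definition ricci_coef (A B : I) (z : E) : R := \sum_D curv_coef D A B D z.

Definition ricci (z : E) (u v : tvec) : R :=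
  \sum_A \sum_B ricci_coef A B z * coframe A z u * coframe B z v.

(* The gravitational h-potential G. *)
Definition potential (z : E) (u v : tvec) : R :=
  h z.1.1 * coframe it z u * coframe it z v
  + \sum_i \sum_j g z i j * coframe (ix i) z u * coframe (ix j) z v
  + \sum_i \sum_j
      h_inv z.1.1 * g z i j * coframe (iy i) z u * coframe (iy j) z v.

(* The matrix (G^{AB}), indexed through the enumeration of [jindex n]. *)
Definition potential_inv (z : E) : 'M[R]_#|I| :=
  invmx (\matrix_(p, q)
    potential z (frame (enum_val p) z) (frame (enum_val q) z)).

Definition scalar_curv (z : E) : R :=
  \sum_A \sum_B
    potential_inv z (enum_rank A) (enum_rank B) * ricci_coef A B z.

(* Effective components: R^l_{i1k}, R^l_{ijk}, P^{l (1)}_{i1(k)},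
   P^{l (1)}_{ij(k)}, S^{l(1)(1)}_{i(j)(k)}. *)
Definition curvR_t (l i k : 'I_n) (z : E) : R :=
  curv_coef (ix l) (ix i) it (ix k) z.
Definition curvR_x (l i j k : 'I_n) (z : E) : R :=
  curv_coef (ix l) (ix i) (ix j) (ix k) z.
Definition curvP_t (l i k : 'I_n) (z : E) : R :=
  curv_coef (ix l) (ix i) it (iy k) z.
Definition curvP_x (l i j k : 'I_n) (z : E) : R :=
  curv_coef (ix l) (ix i) (ix j) (iy k) z.
Definition curvS (l i j k : 'I_n) (z : E) : R :=
  curv_coef (ix l) (ix i) (iy j) (iy k) z.

(* R_{i1}, R_{ij}, P_{i(j)}, P_{(i)1}, P_{(i)j}, S_{(i)(j)}: the suffix gives
   the types of the two lower indices. *)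
Definition R_xt (i : 'I_n) (z : E) : R := \sum_m curvR_t m i m z.
Definition R_xx (i j : 'I_n) (z : E) : R := \sum_m curvR_x m i j m z.
Definition P_xy (i j : 'I_n) (z : E) : R := - \sum_m curvP_x m i m j z.
Definition P_yt (i : 'I_n) (z : E) : R := \sum_m curvP_t m i m z.
Definition P_yx (i j : 'I_n) (z : E) : R := \sum_m curvP_x m i j m z.
Definition S_yy (i j : 'I_n) (z : E) : R := \sum_m curvS m i j m z.

Definition R_trace (z : E) : R := \sum_i \sum_j g_inv z i j * R_xx i j z.
Definition S_trace (z : E) : R :=
  \sum_i \sum_j h z.1.1 * g_inv z i j * S_yy i j z.

End LocalGeometry.

Section LagrangeSpace.
Variables (R : realType) (n : nat) (M : smooth_manifold R n).
Local Notation E := (coords R n).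

(* h is given by its component in the standard coordinate of the time axis. *)
Definition semi_riemannian (h : R -> R) : Prop :=
  smooth_on setT h /\ forall t, h t != 0.

(* h~_11 = h_11 (dt/dt~)^2. *)
Definition h_local (h : R -> R) (C : jet_chart M) (s : R) : R :=
  h (tinv C.1 s) * (derive1 (tinv C.1) s) ^+ 2.

Definition smooth_jet (f : jet M -> R) : Prop :=
  forall C : jet_chart M, smooth_on (jran C) (local_expr C f).

(* g~_ij = (dx^k/dx~^i) (dx^l/dx~^j) g_kl. *)
Definition is_dtensor (g : jet_chart M -> E -> 'M[R]_n) : Prop :=
  forall (C C' : jet_chart M) (z : E), joverlap C' C z -> forall i j,
    let dx (k i : 'I_n) :=
      ('D_(delta_mx 0 i) (transition C'.2 C.2) z.1.2 : 'rV[R]_n) 0 k in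
    g C' z i j =
      \sum_k \sum_l dx k i * dx l j * g C (jchange C' C z) k l.

Record lagrange_space (h : R -> R) (L : jet M -> R)
    (g : jet_chart M -> E -> 'M[R]_n) : Prop := LagrangeSpace {
  lagrangian_smooth : smooth_jet L;
  g_dtensor : is_dtensor g;
  g_symmetric : forall C z, jran C z -> (g C z)^T = g C z;
  g_rank : forall C z, jran C z -> \rank (g C z) = n;
  g_signature : exists p q, forall C z, jran C z ->
    has_signature p q (g C z);
  h_regular : forall C z, jran C z -> forall i j,
    2^-1 * partial (iy i) (partial (iy j) (local_expr C L)) z =
      h_inv (h_local h C) z.1.1 * g C z i j
}.

(* A smooth tensor field of type (0,2) on E, given by its components in the
   natural bases of all the charts. *)
Definition is_tensor02
    (T : jet_chart M -> E -> jindex n -> jindex n -> R) : Prop :=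
  (forall C a b, smooth_on (jran C) (fun z => T C z a b)) /\
  (forall (C C' : jet_chart M) (z : E), joverlap C' C z -> forall a b,
    T C' z a b =
      \sum_c \sum_d
        partial a (fun w => jcoord c (jchange C' C w)) z
        * partial b (fun w => jcoord d (jchange C' C w)) z
        * T C (jchange C' C z) c d).

End LagrangeSpace.

(* Main.v *)
(* In the adapted frame the curvature of CGamma is given by the classical
   formula in terms of the coefficients Gamma and of the brackets of the frame
   fields.  CGamma preserves the three blocks of the frame.  On the time block
   its only coefficient is H^1_11, which depends on t alone, so the first row
   of the Ricci d-tensor vanishes; on the vertical block it differs from the
   horizontal block by the flat form -H^1_11 dt, so the vertical curvature
   components appearing in Ricci equal the horizontal ones.  The Ricci
   d-tensor thus consists of R_AB, P_AB, S_AB, and as G is block diagonal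
   its trace is R + S. *)
Require Import Defs.
From HB Require Import structures.
From mathcomp Require Import all_boot all_order all_algebra.
From mathcomp Require Import boolp classical_sets reals topology normedtype.
From mathcomp Require Import derive.
From mathcomp Require Import ring.

Set Implicit Arguments.
Unset Strict Implicit.
Unset Printing Implicit Defensive.

Import Order.TTheory GRing.Theory Num.Theory.
Import numFieldNormedType.Exports.

Local Open Scope ring_scope.

(** * Sums over the three index blocks and Kronecker deltas *)

Lemma sum_jindex (V : nmodType) n (F : jindex n -> V) :
  \sum_A F A = F it + \sum_i F (ix i) + \sum_i F (iy i).
Proof.
rewrite big_sumType big_sumType /=; congr (_ + _ + _).
by rewrite (big_pred1 tt) //; case.
Qed.

Lemma sum_mul_delta (R : pzRingType) (I : finType) (F : I -> R) (i : I) :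
  \sum_j F j * (j == i)%:R = F i.
Proof.
rewrite (bigD1 i) //= eqxx mulr1 big1 ?addr0 // => j /negPf ->.
by rewrite mulr0.
Qed.

Lemma sum_delta_mul (R : pzRingType) (I : finType) (F : I -> R) (i : I) :
  \sum_j (j == i)%:R * F j = F i.
Proof.
rewrite -[RHS](sum_mul_delta F i); apply: eq_bigr => j _.
by case: (j == i); rewrite ?mulr1 ?mul1r ?mulr0 ?mul0r.
Qed.

(* Also valid where f and g have no derivative, 'D_v being a total limit. *)
Lemma derive_shift_eq (R : realType) (V : normedModType R) (f g : V -> R)
    (x v : V) (c : R) :
  (forall s : R, f (s *: v + x) = g (s *: v + x) + c) -> 'D_v f x = 'D_v g x.
Proof.
move=> fg; rewrite /derive.
rewrite (_ : (fun s : R => _) = fun s : R =>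
  s^-1 *: ((g \o shift x) (s *: v) - g x)) //.
apply: funext => s /=; rewrite fg.
have := fg 0; rewrite scale0r add0r => ->.
by congr (_ *: _); ring.
Qed.

Section AdaptedFrame.
Variables (R : realType) (n : nat).
Local Notation E := (coords R n).
Local Notation I := (jindex n).
Variables (h : R -> R) (L : E -> R) (g : E -> 'M[R]_n).
Local Notation e := (frame h L g).
Local Notation theta := (coframe h L g).
Local Notation Gam := (cartan h L g).

(** * Duality of the adapted frame and coframe *)

Lemma coframe_frame (A B : I) z : theta A z (e B z) = (A == B)%:R.
Proof.
case: A B => [[[]|i]|i] [[[]|j]|j] //=.
- by rewrite mulr1 big1 ?addr0 ?addNr // => k _; rewrite mulr0.
- by rewrite mulr0 addr0 sum_mul_delta addNr.
- by rewrite mulr0 addr0 big1 ?addr0 // => k _; rewrite mulr0.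
Qed.

Lemma frame_coframe z (u : tvec R n) a : u a = \sum_A theta A z u * e A z a.
Proof.
rewrite sum_jindex; case: a => [[[]|i]|i] /=.
- by rewrite mulr1 !big1 ?addr0 // => k _; rewrite mulr0.
- rewrite mulr0 add0r [X in _ + X]big1 => [|k _]; last by rewrite mulr0.
  rewrite addr0 -[LHS](sum_mul_delta (fun k => u (ix k)) i).
  by apply: eq_bigr => k _; rewrite eq_sym.
- under [X in _ + X]eq_bigr => k _ do rewrite eq_sym.
  rewrite sum_mul_delta.
  under eq_bigr => k _ do rewrite mulrN mulrC.
  by rewrite sumrN /iy /it /ix; ring.
Qed.

Lemma coframe_sum (F : I -> R) D z :
  theta D z (fun a => \sum_C F C * e C z a) = F D.
Proof.
have lin : forall J (r : seq J) (G : J -> R) (w : J -> tvec R n),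
    theta D z (fun a => \sum_(j <- r) G j * w j a)
    = \sum_(j <- r) G j * theta D z (w j).
  move=> J r G w; case: D => [[[]|i]|i] //=.
  under [in RHS]eq_bigr => j _ do rewrite !mulrDr mulr_sumr.
  rewrite !big_split /= exchange_big /= mulr_sumr; congr (_ + _ + _).
    by apply: eq_bigr => j _; ring.
  apply: eq_bigr => k _; rewrite mulr_sumr.
  by apply: eq_bigr => j _; ring.
rewrite lin; under eq_bigr => C _ do rewrite coframe_frame eq_sym.
exact: sum_mul_delta.
Qed.

Lemma coframeB D z (u v : tvec R n) :
  theta D z (fun a => u a - v a) = theta D z u - theta D z v.
Proof.
case: D => [[[]|i]|i] //=.
under eq_bigr => k _ do rewrite mulrBr.
by rewrite sumrB; ring.
Qed.

(** * Covariant derivatives and curvature in the adapted frame *)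

Lemma lie_deriv_cst (X : vfield R n) c z : lie_deriv X (fun=> c) z = 0.
Proof.
rewrite /lie_deriv big1 // => a _.
by rewrite /partial (derive_cst c) mulr0.
Qed.

(** The connection form omega^C_A of the adapted frame, evaluated on [X]. *)
Definition nabla_coef (X : vfield R n) (C A : I) (z : E) : R :=
  \sum_B Gam C A B z * theta B z (X z).

(** The components of [e A] in its own frame are constant, so the derivative term of [nabla] drops
    out. *)
Lemma nabla_frame (X : vfield R n) (A : I) :
  nabla h L g X (e A) = fun z a => \sum_C nabla_coef X C A z * e C z a.
Proof.
apply: funext => z; apply: funext => a; apply: eq_bigr => C _; congr (_ * _).
rewrite [X in lie_deriv _ X](_ : _ = fun=> (C == A)%:R); last first.
  by apply: funext => w; rewrite coframe_frame.
rewrite lie_deriv_cst add0r exchange_big; apply: eq_bigr => B _ /=.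
under eq_bigr => D _ do rewrite coframe_frame mulrAC.
by rewrite sum_mul_delta.
Qed.

Lemma nabla_coef_frame A B C z : nabla_coef (e B) C A z = Gam C A B z.
Proof.
rewrite /nabla_coef; under eq_bigr => D _ do rewrite coframe_frame.
exact: sum_mul_delta.
Qed.

Lemma nabla_nabla_frame A B C D z :
  theta D z (nabla h L g (e C) (nabla h L g (e B) (e A)) z)
  = lie_deriv (e C) (Gam D A B) z + \sum_F Gam F A B z * Gam D F C z.
Proof.
rewrite nabla_frame {1}/nabla coframe_sum; congr (_ + _).
  congr (lie_deriv _ _ z); apply: funext => w.
  by rewrite coframe_sum nabla_coef_frame.
apply: eq_bigr => F _; rewrite coframe_sum nabla_coef_frame.
under eq_bigr => G _ do rewrite coframe_frame.
by rewrite sum_mul_delta mulrC.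
Qed.

(** The numbers [theta F z (bracket (e C) (e B) z)] are the anholonomy coefficients of the frame.
    They stay unevaluated: later only their antisymmetry and their vanishing for [F = it] are
    used. *)
Lemma curv_coefE D A B C z :
  curv_coef h L g D A B C z =
    lie_deriv (e C) (Gam D A B) z - lie_deriv (e B) (Gam D A C) z
    + \sum_F (Gam F A B z * Gam D F C z - Gam F A C z * Gam D F B z)
    - \sum_F Gam D A F z * theta F z (bracket (e C) (e B) z).
Proof.
rewrite /curv_coef /curvature !coframeB !nabla_nabla_frame nabla_frame.
by rewrite coframe_sum sumrB /nabla_coef; ring.
Qed.

(** * Symmetry, vanishing and comparison of curvature components *)

Lemma bracketC (X Y : vfield R n) z a : bracket X Y z a = - bracket Y X z a.
Proof. by rewrite /bracket opprB. Qed.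

(** Every frame field has constant dt-component, 1 or 0. Hence terms in [H], which occur only along
    the time direction, never enter through brackets. *)
Lemma bracket_frame_t A B z : bracket (e A) (e B) z it = 0.
Proof.
by case: A B => [[[]|i]|i] [[[]|j]|j]; rewrite /bracket /= !lie_deriv_cst subrr.
Qed.

Lemma curv_coef_anti D A B C z :
  curv_coef h L g D A B C z = - curv_coef h L g D A C B z.
Proof.
have br F : theta F z (bracket (e C) (e B) z)
            = - theta F z (bracket (e B) (e C) z).
  rewrite (_ : bracket (e C) (e B) z
             = fun a => (fun=> 0) a - bracket (e B) (e C) z a); last first.
    by apply: funext => a; rewrite bracketC sub0r.
  rewrite coframeB -[RHS]sub0r; congr (_ - _).
  case: F => [[[]|i]|i] //=.
  by rewrite mulr0 big1 ?addr0 // => k _; rewrite mulr0.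
rewrite !curv_coefE; under [X in _ - X]eq_bigr => F _ do rewrite br mulrN.
by rewrite sumrN !sumrB; ring.
Qed.

(** For [A != it] the field [e A] has no d/dt-component, so it differentiates only along lines of
    constant t, where [u] is constant. *)
Lemma lie_deriv_shift (A : I) (f f' : E -> R) (u : R -> R) z :
  A != it -> (forall w, f w = f' w + u w.1.1) ->
  lie_deriv (e A) f z = lie_deriv (e A) f' z.
Proof.
move=> At ff'; rewrite /lie_deriv !sum_jindex.
have eA0 : e A z it = 0 by case: A At => [[[]|i]|i].
rewrite eA0 !mul0r; congr (_ + _ + _); apply: eq_bigr => i _; congr (_ * _);
  apply: (@derive_shift_eq _ _ _ _ _ _ (u z.1.1)) => s;
  by rewrite ff' /= scaler0 add0r.
Qed.

Lemma curv_coef_t (A : I) z : curv_coef h L g it it A it z = 0.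
Proof.
case: (eqVneq A it) => [->|At].
  (* Antisymmetry makes this component its own opposite, and 2 is invertible. *)
  apply/eqP; have /eqP := curv_coef_anti it it it it z.
  by rewrite -addr_eq0 -mulr2n mulrn_eq0.
rewrite curv_coefE.
have -> : lie_deriv (e A) (Gam it it it) z = 0.
  rewrite -[RHS](lie_deriv_cst (e A) 0 z).
  by apply: (@lie_deriv_shift _ _ _ (H h)) => // w; rewrite add0r.
(* The time field is parallel in horizontal and vertical directions. *)
have -> : Gam it it A = fun=> 0 by apply: funext; case: A At => [[[]|i]|i].
rewrite lie_deriv_cst subrr add0r big1 ?sub0r => [|F _]; last first.
  by case: A At F => [[[]|i]|i] // _ [[[]|k]|k] /=; ring.
rewrite big1 ?oppr0 // => F _.
case: F => [[[]|i]|i] /=; rewrite ?mul0r //.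
by rewrite bracket_frame_t mulr0.
Qed.

(** The extra form -H dt is a multiple of the identity, so it cancels in the quadratic term; H(t) is
    killed by vertical derivatives, and dt vanishes on brackets of frame fields. *)
Lemma curv_coef_vertical (l i k : 'I_n) (B : I) z :
  curv_coef h L g (iy l) (iy i) B (iy k) z
  = curv_coef h L g (ix l) (ix i) B (iy k) z.
Proof.
rewrite !curv_coefE; congr (_ - _ + _ - _).
- case: B => [[[]|j]|j] //.
  by apply: (@lie_deriv_shift _ _ _ (fun t => - ((l == i)%:R * H h t))).
- rewrite !sum_jindex.
  case: B => [[[]|j]|j] /=;
    rewrite ?(mul0r, mulr0, subrr, add0r, big1_eq, addr0) //.
  (* Here [B = it]: the delta-sums split off both evaluate to H C^l_ik and cancel. *)
  rewrite (eq_bigr (fun F =>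
    (cartan_G h L g F i z * cartan_C g l F k z
     - cartan_C g F i k z * cartan_G h L g l F z)
    - ((F == i)%:R * (H h z.1.1 * cartan_C g l F k z)
       - (cartan_C g F i k z * H h z.1.1) * (F == l)%:R)))
    => [|F _]; last first.
    by rewrite (eq_sym F l); ring.
  rewrite sumrB [X in _ - X]sumrB sum_delta_mul sum_mul_delta.
  by rewrite mulrC subrr subr0.
- apply: eq_bigr => -[[[]|F]|F] _ //.
  by rewrite /= bracket_frame_t !mulr0.
Qed.

Definition same_block (A B : I) : bool :=
  match A, B with
  | inl (inl _), inl (inl _) => true
  | inl (inr _), inl (inr _) => true
  | inr _, inr _ => true
  | _, _ => false
  end.

(** Connection coefficients vanish between different blocks, and a nonzero quadratic term would need
    [F] in the block of [A] and in that of [D] at once. *)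
Lemma curv_coef_block D A B C z :
  ~~ same_block D A -> curv_coef h L g D A B C z = 0.
Proof.
move=> DA; have Gam0 F : Gam D A F = fun=> 0.
  by apply: funext => w; case: D A F DA => [[[]|i]|i] [[[]|j]|j] [[[]|k]|k].
rewrite curv_coefE !Gam0 !lie_deriv_cst subrr add0r.
rewrite !big1 ?subr0 // => F _; first by rewrite Gam0 mul0r.
have Gam00 X Y w : Gam F A X w * Gam D F Y w = 0.
  case: D A F DA {Gam0} X Y =>
    [[[]|i]|i] [[[]|j]|j] [[[]|k]|k] //= _ X Y;
    by case: X => [[[]|?]|?] /=; rewrite ?mul0r //;
      case: Y => [[[]|?]|?] /=; rewrite ?mulr0.
by rewrite !Gam00 subrr.
Qed.

(** * The Ricci d-tensor, block by block *)

Lemma ricci_coef_t B z : ricci_coef h L g it B z = 0.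
Proof.
rewrite /ricci_coef sum_jindex curv_coef_t !big1 ?addr0 // => i _;
  exact: curv_coef_block.
Qed.

Lemma ricci_coef_x i B z : ricci_coef h L g (ix i) B z =
  \sum_m curv_coef h L g (ix m) (ix i) B (ix m) z.
Proof.
rewrite /ricci_coef sum_jindex curv_coef_block // add0r.
rewrite [X in _ + X]big1 ?addr0 //.
by move=> m _; apply: curv_coef_block.
Qed.

(** The trace reduces to vertical [D]; its last index is then vertical too, which is the case
    covered by [curv_coef_vertical]. *)
Lemma ricci_coef_y i B z : ricci_coef h L g (iy i) B z =
  \sum_m curv_coef h L g (ix m) (ix i) B (iy m) z.
Proof.
rewrite /ricci_coef sum_jindex curv_coef_block // add0r big1 ?add0r //.
  by apply: eq_bigr => m _; apply: curv_coef_vertical.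
by move=> m _; apply: curv_coef_block.
Qed.

(** * The potential G, its inverse, and tensor equations tested on the frame *)

Definition potential_coef (z : E) (A B : I) : R :=
  match A, B with
  | inl (inl _), inl (inl _) => h z.1.1
  | inl (inr i), inl (inr j) => g z i j
  | inr i, inr j => h_inv h z.1.1 * g z i j
  | _, _ => 0
  end.

(** The blockwise inverse of [potential_coef], shown to be (G^{AB}) in [potential_invE]. The
    vertical block carries h_11 because that of G carries h^11. *)
Definition potential_inv_coef (z : E) (A B : I) : R :=
  match A, B with
  | inl (inl _), inl (inl _) => h_inv h z.1.1
  | inl (inr i), inl (inr j) => g_inv g z i j
  | inr i, inr j => h z.1.1 * g_inv g z i j
  | _, _ => 0
  end.

Lemma potentialE z u v : potential h L g z u v =
  \sum_A \sum_B potential_coef z A B * theta A z u * theta B z v.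
Proof.
rewrite sum_jindex /potential; congr (_ + _ + _).
- by rewrite sum_jindex !big1 ?addr0 // => i _; rewrite !mul0r.
- apply: eq_bigr => i _; rewrite sum_jindex !mul0r add0r.
  rewrite [X in _ + X]big1 ?addr0 //.
  by move=> j _; rewrite !mul0r.
- apply: eq_bigr => i _; rewrite sum_jindex !mul0r add0r.
  rewrite [X in X + _]big1 ?add0r //.
  by move=> j _; rewrite !mul0r.
Qed.

Lemma sum_frame (F : I -> I -> R) A B z :
  \sum_A' \sum_B' F A' B' * theta A' z (e A z) * theta B' z (e B z) = F A B.
Proof.
rewrite -[RHS](sum_mul_delta (fun A' => F A' B)); apply: eq_bigr => A' _.
rewrite -(sum_mul_delta (fun B' => F A' B')) mulr_suml; apply: eq_bigr => B' _.
by rewrite !coframe_frame mulrAC.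
Qed.

Lemma potential_frame A B z :
  potential h L g z (e A z) (e B z) = potential_coef z A B.
Proof. by rewrite potentialE sum_frame. Qed.

Lemma ricci_frame A B z :
  ricci h L g z (e A z) (e B z) = ricci_coef h L g A B z.
Proof. by rewrite /ricci sum_frame. Qed.

(** Passes by bilinearity from components in the natural basis, in which [T] is given, to adapted
    components. *)
Lemma tensor_eval_frame (T : I -> I -> R) u v z :
  tensor_eval T u v =
  \sum_A \sum_B tensor_eval T (e A z) (e B z) * theta A z u * theta B z v.
Proof.
rewrite /tensor_eval pair_bigA [RHS]pair_bigA /=.
under eq_bigr => p _.
  rewrite (frame_coframe z u) (frame_coframe z v).
  rewrite [X in X * _]mulr_sumr mulr_suml.
  under eq_bigr => A _ do rewrite mulr_sumr.
  rewrite pair_bigA /=; over.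
rewrite exchange_big /=; apply: eq_bigr => q _.
rewrite pair_bigA !mulr_suml /=; apply: eq_bigr => p _; ring.
Qed.

Lemma potential_invE z A B : h z.1.1 != 0 -> g z \in unitmx ->
  potential_inv h L g z (enum_rank A) (enum_rank B) = potential_inv_coef z A B.
Proof.
move=> h0 gU.
pose P : 'M[R]_#|I| := \matrix_(p, q)
  potential h L g z (frame h L g (enum_val p) z) (frame h L g (enum_val q) z).
pose Q : 'M[R]_#|I| := \matrix_(p, q)
  potential_inv_coef z (enum_val p) (enum_val q).
(* For square matrices a left inverse suffices. *)
have QP : Q *m P = 1%:M.
  have gg i j : \sum_k g_inv g z i k * g z k j = (i == j)%:R.
    by have /matrixP/(_ i j) := mulVmx gU; rewrite !mxE.
  apply/matrixP => p q; rewrite !mxE.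
  under eq_bigr => r _ do rewrite !mxE potential_frame.
  (* Moves the sum from matrix positions back to [jindex n], so that it splits into blocks. *)
  rewrite -(big_enum_val (fun A =>
    potential_inv_coef z (enum_val p) A * potential_coef z A (enum_val q))) /=.
  rewrite sum_jindex -(inj_eq enum_val_inj).
  case: (enum_val p) (enum_val q) => [[[]|i]|i] [[[]|j]|j] /=.
  - rewrite /h_inv mulVf // !big1 ?addr0 // => k _; exact: mul0r.
  - rewrite !big1 ?mulr0 ?addr0 // => k _; exact: mul0r.
  - rewrite !big1 ?mulr0 ?addr0 // => k _; exact: mul0r.
  - rewrite !big1 ?mul0r ?addr0 // => k _; exact: mulr0.
  - by rewrite mul0r add0r gg [X in _ + X]big1 ?addr0 // => k _; rewrite mul0r.
  - rewrite !big1 ?mul0r ?addr0 // => k _; rewrite ?mulr0 ?mul0r //.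
  - rewrite !big1 ?mul0r ?addr0 // => k _; exact: mulr0.
  - rewrite !big1 ?mul0r ?addr0 // => k _; rewrite ?mulr0 ?mul0r //.
  - rewrite mul0r add0r big1_eq add0r.
    rewrite -[RHS]gg; apply: eq_bigr => k _.
    by rewrite mulrACA /h_inv mulfV // mul1r.
have PU : P \in unitmx by case: (mulmx1_unit QP).
by rewrite /potential_inv -/P -[invmx P]mul1mx -QP mulmxK // mxE !enum_rankK.
Qed.

Lemma scalar_curvE z : h z.1.1 != 0 -> g z \in unitmx ->
  scalar_curv h L g z = R_trace h L g z + S_trace h L g z.
Proof.
move=> h0 gU; rewrite /scalar_curv.
under eq_bigr => A _ do under eq_bigr => B _ do rewrite potential_invE //.
rewrite sum_jindex big1 ?add0r => [|B _]; last by rewrite ricci_coef_t mulr0.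
congr (_ + _); apply: eq_bigr => i _; rewrite sum_jindex mul0r add0r.
  rewrite [X in _ + X]big1 ?addr0 => [|j _]; last exact: mul0r.
  by apply: eq_bigr => j _; rewrite ricci_coef_x.
rewrite big1 ?add0r => [|j _]; last exact: mul0r.
by apply: eq_bigr => j _; rewrite ricci_coef_y.
Qed.

(** Both sides are bilinear in [u] and [v], so the equation can be tested on pairs of frame vectors.
    The scalar [s] stands for half the scalar curvature. *)
Lemma einstein_frame (T : I -> I -> R) (s k : R) z :
  (forall u v, ricci h L g z u v - s * potential h L g z u v
               = k * tensor_eval T u v) <->
  (forall A B, ricci_coef h L g A B z - s * potential_coef z A B
               = k * tensor_eval T (e A z) (e B z)).
Proof.
split=> [eqn A B|eqn u v].
  by rewrite -ricci_frame -potential_frame eqn.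
rewrite potentialE (tensor_eval_frame T u v z) /ricci !mulr_sumr -sumrB.
apply: eq_bigr => A _; rewrite !mulr_sumr -sumrB.
by apply: eq_bigr => B _; rewrite !mulrA -!eqn; ring.
Qed.

End AdaptedFrame.

(** By the chain rule for [tmap c \o tinv c], this derivative is a factor of 1. It ensures that h_11
    is nonzero in every time chart. *)
Lemma derive1_tinv_neq0 (R : realType) (c : time_chart R) (s : R) :
  (tmap c @` tdom c)%classic s -> derive1 (tinv c) s != 0.
Proof.
move=> [t tD <-]; have sD : (tmap c @` tdom c)%classic (tmap c t) by exists t.
have d1 : derivable (tinv c) (tmap c t) 1.
  (* The empty list of directions selects the map itself among its iterated derivatives. *)
  by apply/derivable1_diffP; exact: (tinv_smooth [::] sD).
have d2 : derivable (tmap c) (tinv c (tmap c t)) 1.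
  by apply/derivable1_diffP; rewrite tmapK //; exact: (tmap_smooth [::] tD).
have := derive1_comp d1 d2.
have -> : derive1 (tmap c \o tinv c) (tmap c t) = 1.
  (* The composite is the identity only on the range of the chart, which is open and so a
     neighbourhood of the point. *)
  rewrite -[RHS](derive1_id (tmap c t)) !derive1E; apply: near_eq_derive.
  have := open_nbhs_nbhs (conj (@tran_open _ c) sD).
  by apply: filterS => _ [t' t'D <-] /=; rewrite tmapK.
move=> /esym/eqP; apply: contraL => /eqP ->.
by rewrite mulr0 eq_sym oner_eq0.
Qed.

(** * The Einstein equations in an arbitrary chart *)

Theorem theorem4p2p3 (R : realType) (n : nat) (M : smooth_manifold R n)
    (h : R -> R) (L : jet M -> R)
    (g : jet_chart M -> coords R n -> 'M[R]_n)
    (T : jet_chart M -> coords R n -> jindex n -> jindex n -> R) (K : R)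
    (h_metric : semi_riemannian h)
    (RL : lagrange_space h L g)
    (T_tensor : is_tensor02 T)
    (K_neq0 : K != 0)
    (C : jet_chart M) (z : coords R n) (z_in : jran C z) :
  let hC := h_local h C in
  let LC := local_expr C L in
  let gC := g C in
  let h11 := hC z.1.1 in
  let e (A : jindex n) := frame hC LC gC A z in
  let TA (A B : jindex n) := tensor_eval (T C z) (e A) (e B) in
  let RS := R_trace hC LC gC z + S_trace hC LC gC z in
  (forall u v : tvec R n,
     ricci hC LC gC z u v - scalar_curv hC LC gC z / 2 * potential hC LC gC z u v
     = K * tensor_eval (T C z) u v)
  <->
  ([/\ - (RS / 2) * h11 = K * TA it it,
       forall i j, R_xx hC LC gC i j z - RS / 2 * gC z i j
                   = K * TA (ix i) (ix j) &
       forall i j, S_yy hC LC gC i j z - RS / 2 * h11^-1 * gC z i j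
                   = K * TA (iy i) (iy j)]
   /\
   [/\ (forall i, 0 = TA it (ix i)),
       (forall i, R_xt hC LC gC i z = K * TA (ix i) it) &
       (forall i, P_yt hC LC gC i z = K * TA (iy i) it)]
   /\
   [/\ (forall i, 0 = TA it (iy i)),
       (forall i j, P_xy hC LC gC i j z = K * TA (ix i) (iy j)) &
       (forall i j, P_yx hC LC gC i j z = K * TA (iy i) (ix j))]).
Proof.
move=> hC LC gC h11 e TA RS.
have h0 : hC z.1.1 != 0.
  case: h_metric z_in => _ hn0 [sD _].
  by rewrite mulf_neq0 // expf_neq0 // derive1_tinv_neq0.
have gU : gC z \in unitmx.
  by rewrite -row_full_unit /row_full (g_rank RL z_in).
apply: (iff_trans (einstein_frame _ _ _ _ _ _ _)).
rewrite scalar_curvE // -/RS.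
(* Divides by the Einstein constant in the two families where both Ricci and G vanish. *)
have K0 x : 0 = K * x <-> 0 = x.
  split=> [|<-]; last by rewrite mulr0.
  by move/esym/eqP; rewrite mulf_eq0 (negPf K_neq0) => /eqP.
have Rxx i j : ricci_coef hC LC gC (ix i) (ix j) z = R_xx hC LC gC i j z.
  exact: ricci_coef_x.
have Syy i j : ricci_coef hC LC gC (iy i) (iy j) z = S_yy hC LC gC i j z.
  exact: ricci_coef_y.
have Rxt i : ricci_coef hC LC gC (ix i) it z = R_xt hC LC gC i z.
  exact: ricci_coef_x.
have Pyt i : ricci_coef hC LC gC (iy i) it z = P_yt hC LC gC i z.
  exact: ricci_coef_y.
have Pyx i j : ricci_coef hC LC gC (iy i) (ix j) z = P_yx hC LC gC i j z.
  exact: ricci_coef_y.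
(* Ricci contracts R^m_{i(j)m}, while P is defined from R^m_{im(j)}: exchanging the last two indices
   yields the minus sign. *)
have Pxy i j : ricci_coef hC LC gC (ix i) (iy j) z = P_xy hC LC gC i j z.
  rewrite ricci_coef_x /P_xy -sumrN; apply: eq_bigr => m _.
  exact: curv_coef_anti.
(* The pairs of blocks match the nine equations one by one; in the six mixed ones G vanishes. *)
split=> [eqn|[[Ett Exx Eyy] [[Etx Ext Eyt] [Ety Exy Eyx]]] A B].
  split; [split|split; split].
  - by rewrite -eqn ricci_coef_t sub0r mulNr.
  - by move=> i j; rewrite -eqn Rxx.
  - by move=> i j; rewrite -eqn Syy mulrA.
  - by move=> i; apply/K0; rewrite -eqn ricci_coef_t mulr0 subrr.
  - by move=> i; rewrite -eqn Rxt mulr0 subr0.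
  - by move=> i; rewrite -eqn Pyt mulr0 subr0.
  - by move=> i; apply/K0; rewrite -eqn ricci_coef_t mulr0 subrr.
  - by move=> i j; rewrite -eqn Pxy mulr0 subr0.
  - by move=> i j; rewrite -eqn Pyx mulr0 subr0.
case: A B => [[[]|i]|i] [[[]|j]|j].
- by rewrite ricci_coef_t sub0r -mulNr.
- by rewrite ricci_coef_t mulr0 subrr; apply/K0; exact: Etx.
- by rewrite ricci_coef_t mulr0 subrr; apply/K0; exact: Ety.
- by rewrite Rxt mulr0 subr0.
- by rewrite Rxx.
- by rewrite Pxy mulr0 subr0.
- by rewrite Pyt mulr0 subr0.
- by rewrite Pyx mulr0 subr0.
- by rewrite Syy -Eyy /= mulrA.
Qed.
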